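(* Let $\Gamma_1$ be a finite abelian group and $\Gamma_2$ a countable discrete abelian torsion group with finite exponent such that the exponents of $\Gamma_1$ and $\Gamma_2$ are coprime. If $(a_n)_{n \in \mathbb{N}} = (a_{n,1}, a_{n,2})_{n \in \mathbb{N}}$ is a rigidity sequence for a free action of $\Gamma_1 \oplus \Gamma_2$, then $a_{n,1} = 0$ for all but finitely many $n \in \mathbb{N}$.
   Context: The exponent of an abelian group is the smallest $n\in\mathbb{N}$ with $nx=0$ for every element $x$ (infinite if there is none). For a countable discrete abelian group $\Gamma$, an action (measure-preserving system) is a quadruple $(X, \mathcal{B}, \mu, (T_g)_{g \in \Gamma})$, where $(X,\mathcal{B},\mu)$ is a non-atomic Lebesgue probability space and $(T_g)_{g\in\Gamma}$ is an action of $\Gamma$ by measure-preserving transformations. A sequence $(a_n)_{n\in\mathbb{N}}$ in $\Gamma$ is a rigidity sequence for the action if $\|f\circ T_{a_n} - f\|_2 \to 0$ for every $f \in L^2(\mu)$. The action is free if $\mu(\{x\in X : T_gx = x\}) = 0$ for every $g\in\Gamma\setminus\{0\}$. *)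

(* Defs.v *)
From HB Require Import structures.
From mathcomp Require Import all_boot all_order all_algebra.
From mathcomp Require Import all_classical all_reals all_analysis.
From mathcomp Require Import measurable_realfun.

Set Implicit Arguments.
Unset Strict Implicit.
Unset Printing Implicit Defensive.

Import Order.TTheory GRing.Theory Num.Theory.
Import numFieldNormedType.Exports.

Local Open Scope classical_set_scope.
Local Open Scope ring_scope.

(* A group of infinite exponent satisfies [is_exponent G n] for no [n]. *)
Definition is_exponent (G : zmodType) (n : nat) : Prop :=
  [/\ (0 < n)%N, (forall x : G, x *+ n = 0)
    & forall m, (0 < m)%N -> (forall x : G, x *+ m = 0) -> (n <= m)%N].

(* Isomorphism mod 0 of the completion of (X, P) with [0, 1] carrying the
   Lebesgue sigma-algebra and the Lebesgue measure.  P itself need not be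
   complete, so this covers both usual conventions for non-atomic Lebesgue
   spaces: Rokhlin's (complete) and the standard Borel one.  On the completed
   sigma-algebra the outer measure P^* is the completion of P. *)
Definition nonatomic_lebesgue_space (d : measure_display)
    (X : measurableType d) (R : realType) (P : probability X R) : Prop :=
  exists (phi : X -> R) (N : set X) (M : set R),
    [/\ P.-negligible N,
        (@lebesgue_measure R).-negligible M,
        set_bij (~` N) (`[0, 1] `\` M) phi,
        (forall A : set X, A `<=` ~` N ->
          (completed_algebra_gen P A <->
           completed_algebra_gen (@lebesgue_measure R) (phi @` A)))
      & (forall A : set X, A `<=` ~` N -> completed_algebra_gen P A ->
          (P^*)%mu A = completed_lebesgue_measure (phi @` A))].

Record is_mp_action (d : measure_display) (X : measurableType d)
    (R : realType) (P : probability X R) (G : zmodType) (T : G -> X -> X) :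
    Prop := IsMpAction {
  mp_action0 : forall x, T 0 x = x;
  mp_actionD : forall g h x, T (g + h) x = T g (T h x);
  mp_action_measurable : forall g, measurable_fun setT (T g);
  mp_action_preserving :
    forall g A, measurable A -> P (T g @^-1` A) = P A
}.

(* In a space whose sigma-algebra is not complete, "measure 0" is meant in the
   completion, hence [negligible]; for a measurable fixed-point set this is
   [P _ = 0] (lemma negligibleP). *)
Definition free_action (d : measure_display) (X : measurableType d)
    (R : realType) (P : probability X R) (G : zmodType) (T : G -> X -> X) :
    Prop :=
  forall g, g <> 0 -> P.-negligible [set x | T g x = x].

(* L^2 is the real one; splitting into real and imaginary parts shows that
   convergence for complex-valued functions is the same condition. *)
Definition rigidity_sequence (d : measure_display) (X : measurableType d)
    (R : realType) (P : probability X R) (G : zmodType) (T : G -> X -> X)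
    (a : nat -> G) : Prop :=
  forall f : X -> R, f \in Lfun P 2%:E ->
    'N[P]_2%:E[EFin \o ((f \o T (a n)) \- f)%R]%E @[n --> \oo] --> 0%E.

(* Main.v *)
(* By the Chinese remainder theorem there is k with k = 1 modulo the exponent of
   G1 and k = 0 modulo the exponent of G2, so that k a_n = (a_{n,1}, 0).  For a
   measurable set A, P(T_(k a_n)^-1 A + A) <= k P(T_(a_n)^-1 A + A) tends to 0.
   If a_{n,1} took a value g <> 0 infinitely often, T_(g,0) would therefore
   preserve every measurable set mod 0; as countably many measurable sets
   separate the points of a Lebesgue space mod 0, T_(g,0) would be the identity
   almost everywhere, contradicting freeness. *)
Require Import Defs.
From HB Require Import structures.
From mathcomp Require Import all_boot all_order all_algebra.
From mathcomp Require Import all_classical all_reals all_analysis.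
From mathcomp Require Import measurable_realfun.

Set Implicit Arguments.
Unset Strict Implicit.
Unset Printing Implicit Defensive.

Import Order.TTheory GRing.Theory Num.Theory.
Import numFieldNormedType.Exports.

Local Open Scope classical_set_scope.
Local Open Scope ring_scope.

Lemma measurable_setY (d : measure_display) (X : measurableType d)
    (A B : set X) :
  measurable A -> measurable B -> measurable (A `+` B).
Proof. by move=> mA mB; apply: measurableU; exact: measurableD. Qed.

Lemma setY_out (X : Type) (A B : set X) (x : X) :
  ~ (A `+` B) x -> A x <-> B x.
Proof.
rewrite /setY /= => nAB; split => [Ax|Bx]; apply: contrapT => n; apply: nAB;
  by [left|right].
Qed.

Lemma indic_subE (X : Type) (R : realType) (A B : set X) (x : X) :
  `|\1_A x - \1_B x : R| = \1_(A `+` B) x.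
Proof.
rewrite !indicE /setY !in_setU !in_setD.
by case: (x \in A); case: (x \in B) => /=;
  rewrite ?(subrr, subr0, sub0r, normrN, normr1, normr0).
Qed.

(** Since [M] need not be measurable, take a measurable null set [M'] containing it: [C] minus [M']
    is measurable, and the rest of the set lies inside [M']. *)
Lemma completed_algebra_gen_setD (d : measure_display) (X : measurableType d)
    (R : realType) (mu : {measure set X -> \bar R}) (C M : set X) :
  measurable C -> mu.-negligible M -> completed_algebra_gen mu (C `\` M).
Proof.
move=> mC [M' [mM' M'0 MM']]; exists (C `\` M'); first exact: measurableD.
exists ((C `&` M') `\` M).
  by exists M'; split => // x [[]].
apply/seteqP; split => x /=.
  by move=> [[Cx nM'x]|[[Cx _] nMx]]; split => // /MM'.
by move=> [Cx nMx]; have [M'x|] := pselect (M' x); [right|left].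
Qed.

(** An indicator equals its own [p]-th power for [p > 0]. Asking only for the absolute value of [f]
    lets this apply to differences of indicators as well. *)
Lemma Lnorm_indic (d : measure_display) (X : measurableType d) (R : realType)
    (mu : {measure set X -> \bar R}) (f : X -> R) (A : set X) (p : R) :
  0 < p -> measurable A -> (forall x, `|f x| = \1_A x) ->
  ('N[mu]_p%:E[EFin \o f] = mu A `^ p^-1)%E.
Proof.
move=> p0 mA fA; rewrite unlock.
under eq_integral => x _.
  rewrite abse_EFin fA poweR_EFin (_ : \1_A x `^ p = \1_A x :> R); last first.
    rewrite indicE; case: (x \in A); rewrite ?powR1// powR0//.
    exact: lt0r_neq0.
  over.
by rewrite integral_indic// setIT.
Qed.

Lemma Lfun_indic (d : measure_display) (X : measurableType d) (R : realType)
    (P : probability X R) (A : set X) (p : R) :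
  0 < p -> measurable A -> (\1_A : X -> R) \in Lfun P p%:E.
Proof.
move=> p0 mA; rewrite inE/=; apply/andP; split; rewrite inE/=.
  exact: measurable_indic.
rewrite /finite_norm (@Lnorm_indic _ _ _ _ _ A)//.
  by rewrite poweR_lty// (le_lt_trans (probability_le1 _ _))// ltry.
by move=> x; rewrite indicE normr_nat.
Qed.

(** Values of [P] lie in [0, 1]. With [p] = 1/2 this bounds a measure by the L^2 norm of the
    indicator. *)
Lemma measure_le_poweR (d : measure_display) (X : measurableType d)
    (R : realType) (P : probability X R) (A : set X) (p : R) :
  measurable A -> p <= 1 -> (P A <= P A `^ p)%E.
Proof.
move=> mA p1; have PA1 := probability_le1 P mA.
have PAfin : P A \is a fin_num by exact: fin_num_measure.
rewrite -(fineK PAfin) poweR_EFin lee_fin.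
have [->|PA0] := eqVneq (fine (P A)) 0; first exact: powR_ge0.
apply: ger1_powR => //; rewrite lt_neqAle eq_sym PA0 fine_ge0//=.
by rewrite -lee_fin fineK.
Qed.

Lemma measurable_preimage_action (d : measure_display) (X : measurableType d)
    (R : realType) (P : probability X R) (G : zmodType) (T : G -> X -> X)
    (g : G) (A : set X) :
  is_mp_action P T -> measurable A -> measurable (T g @^-1` A).
Proof.
move=> hT mA; rewrite -[_ @^-1` _]setTI.
exact: (mp_action_measurable hT g measurableT).
Qed.

Lemma negligible_preimage_action (d : measure_display) (X : measurableType d)
    (R : realType) (P : probability X R) (G : zmodType) (T : G -> X -> X)
    (g : G) (N : set X) :
  is_mp_action P T -> P.-negligible N -> P.-negligible (T g @^-1` N).
Proof.
move=> hT [A [mA PA0 NA]]; exists (T g @^-1` A); split.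
- exact: (measurable_preimage_action _ hT).
- by rewrite (mp_action_preserving hT).
- by move=> x; exact: NA.
Qed.

(* [T_((k+1)g)^-1 A + A] is covered by [T_(kg)^-1 (T_g^-1 A + A)] and
   [T_(kg)^-1 A + A]. *)
Lemma measure_setY_action_mulrn (d : measure_display) (X : measurableType d)
    (R : realType) (P : probability X R) (G : zmodType) (T : G -> X -> X)
    (g : G) (k : nat) (A : set X) :
  is_mp_action P T -> measurable A ->
  (P (T (g *+ k)%R @^-1` A `+` A) <= k%:R%:E * P (T g @^-1` A `+` A))%E.
Proof.
move=> hT mA; have mTY h : measurable (T h @^-1` A `+` A).
  by apply: measurable_setY => //; exact: (measurable_preimage_action _ hT).
elim: k => [|k IH].
  rewrite mulr0n mul0e (_ : T 0 @^-1` A = A) ?setYK ?measure0//.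
  by apply/seteqP; split => x; rewrite /= (mp_action0 hT).
rewrite (@le_trans _ _ (P ((T (g *+ k) @^-1` (T g @^-1` A `+` A)) `|`
    (T (g *+ k) @^-1` A `+` A))))//.
  apply: le_measure; rewrite ?inE//.
    by apply: measurableU => //; exact: (measurable_preimage_action _ hT).
  move=> x; rewrite /setY /= mulrS (mp_actionD hT).
  by have [] := pselect (A (T (g *+ k) x)); tauto.
rewrite (le_trans (measureU2 _ _ _))//.
  exact: (measurable_preimage_action _ hT).
rewrite -add1n natrD EFinD ge0_muleDl// mul1e leeD//.
by rewrite -[leRHS](mp_action_preserving hT (g *+ k) (mTY g)).
Qed.

(** Pull back the half-lines with rational endpoint along [phi]. These preimages are measurable only
    in the completion, so each is replaced by a measurable set, and the null differences are
    absorbed into the exceptional set. *)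
Lemma lebesgue_space_separating (d : measure_display) (X : measurableType d)
    (R : realType) (P : probability X R) : nonatomic_lebesgue_space P ->
  exists (A : nat -> set X) (N : set X),
    [/\ forall n, measurable (A n), P.-negligible N &
        forall x y, ~ N x -> ~ N y -> (forall n, A n x <-> A n y) -> x = y].
Proof.
move=> [phi [N [M [negN negM [phifun phiinj phisurj] phiP _]]]].
(* An enumeration of the rationals; the default 0 at codes of no rational is harmless, since each
   [q] is reached at [pickle q]. *)
pose r n : R := odflt 0 (omap ratr (unpickle n : option rat)).
pose B n := ~` N `&` phi @^-1` `]-oo, r n].
have BN n : B n `<=` ~` N by move=> x [].
have imB n : phi @` B n = (`[0, 1] `&` `]-oo, r n]) `\` M.
  apply/seteqP; split => [_ [x [Nx /= xr] <-]|y [[y01 yr] My]].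
    by have [] := phifun _ Nx.
  by have [x Nx xy] := phisurj _ (conj y01 My); exists x; rewrite // /B /= xy.
have cB n : completed_algebra_gen P (B n).
  apply/(phiP _ (BN n)); rewrite imB; apply: completed_algebra_gen_setD => //.
  by apply: measurableI; exact: measurable_itv.
have /choice[A AB] n : exists A, measurable A /\ P.-negligible (A `+` B n).
  have [A mA [N' negN' AN']] := cB n; exists A; split => //.
  apply: negligibleS negN'; rewrite -AN' => x.
  by rewrite /setY /=; tauto.
exists A, (N `|` \bigcup_n (A n `+` B n)); split.
- by move=> n; have [] := AB n.
- by apply: negligibleU => //; apply: negligible_bigcup => n; have [] := AB n.
move=> x y /not_orP[Nx ABx] /not_orP[Ny ABy] Axy.
have Bxy n : B n x <-> B n y.
  have ABE z : ~ (\bigcup_n (A n `+` B n)) z -> A n z <-> B n z.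
    by move=> ABz; apply: setY_out => ABnz; apply: ABz; exists n.
  by rewrite -(ABE x ABx) -(ABE y ABy).
apply: phiinj; rewrite ?inE//.
(* Otherwise a rational strictly between [phi u] and [phi v] gives some [B n] that contains [u] but
   not [v]. *)
have phile u v : ~ N u -> ~ N v -> (forall n, B n u -> B n v) ->
    phi v <= phi u.
  move=> Nu Nv Buv; rewrite leNgt; apply/negP => /rat_in_itvoo[q].
  rewrite in_itv /= => /andP[uq qv].
  have rq : r (pickle q) = ratr q by rewrite /r pickleK.
  have Bu : B (pickle q) u by split => //=; rewrite in_itv /= rq ltW.
  by have [_ /=] := Buv _ Bu; rewrite in_itv /= rq leNgt qv.
by apply/eqP; rewrite eq_le !phile// => n; apply Bxy.
Qed.

(** If [T g] fixed every measurable set mod 0, almost every [x] would lie in the same separating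
    sets as [T g x], hence be a fixed point; freeness would then make the whole space null. *)
Lemma free_action_moves (d : measure_display) (X : measurableType d)
    (R : realType) (P : probability X R) (G : zmodType) (T : G -> X -> X)
    (g : G) :
  nonatomic_lebesgue_space P -> is_mp_action P T -> free_action P T ->
  g <> 0 -> exists2 A, measurable A & (0 < P (T g @^-1` A `+` A))%E.
Proof.
move=> hP hT hfree g0; apply: contrapT => noA.
have [A [N [mA negN sepA]]] := lebesgue_space_separating hP.
have : P.-negligible [set: X].
  pose F n := T g @^-1` A n `+` A n.
  have negF n : P.-negligible (F n).
    have mF : measurable (F n).
      by apply: measurable_setY => //; exact: (measurable_preimage_action _ hT).
    apply/negligibleP => //; apply/eqP/negPn/negP => PF0; apply: noA.
    by exists (A n) => //; rewrite lt0e PF0 measure_ge0.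
  (* The preimage of [N] appears because separation needs both [x] and [T g x] to avoid [N]. *)
  apply: (@negligibleS _ _ _ _ ([set x | T g x = x] `|` (N `|`
      T g @^-1` N) `|` \bigcup_n F n)); last first.
    apply: negligibleU; last by apply: negligible_bigcup => n; exact: negF.
    apply: negligibleU; first exact: hfree.
    by apply: negligibleU => //; exact: (negligible_preimage_action _ hT).
  move=> x _; apply: contrapT => /not_orP[/not_orP[Tx /not_orP[Nx NTx]] Fx].
  apply: Tx; apply: sepA => // n.
  by apply: (@setY_out _ (T g @^-1` A n)) => Fnx; apply: Fx; exists n.
move/negligibleP => /(_ measurableT) PT0.
have /eqP : 1%E = 0%E :> \bar R by rewrite -PT0 -(probability_setT P).
by rewrite onee_eq0.
Qed.

Lemma rigidity_sequence_measure (d : measure_display) (X : measurableType d)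
    (R : realType) (P : probability X R) (G : zmodType) (T : G -> X -> X)
    (a : nat -> G) (A : set X) :
  is_mp_action P T -> rigidity_sequence P T a -> measurable A ->
  (P (T (a n) @^-1` A `+` A) @[n --> \oo] --> 0)%E.
Proof.
move=> hT ha mA; have mY n : measurable (T (a n) @^-1` A `+` A).
  by apply: measurable_setY => //; exact: (measurable_preimage_action _ hT).
(* Rigidity is applied to the indicator of [A]: the norm is the square root of the measure in
   question, hence an upper bound for it. *)
apply: (squeeze_cvge _ (cvg_cst 0%E) (ha _ (Lfun_indic P (ltr0Sn _ 1) mA))).
apply: nearW => n; rewrite measure_ge0/=.
rewrite (@Lnorm_indic _ _ _ _ _ (T (a n) @^-1` A `+` A))//.
  by apply: measure_le_poweR => //; rewrite invf_le1// ler1n.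
by move=> x; rewrite -indic_subE.
Qed.

(** A single set [A] moved by [g] suffices: whenever [a n *+ k = g], the positive measure of its
    displacement is at most [k] times a quantity tending to 0. *)
Lemma rigidity_sequence_mulrn_finite (d : measure_display)
    (X : measurableType d) (R : realType) (P : probability X R)
    (G : zmodType) (T : G -> X -> X) (a : nat -> G) (k : nat) (g : G) :
  nonatomic_lebesgue_space P -> is_mp_action P T -> free_action P T ->
  rigidity_sequence P T a -> g <> 0 -> finite_set [set n | a n *+ k = g].
Proof.
move=> hP hT hfree ha g0.
have [A mA PA0] := free_action_moves hP hT hfree g0.
have kP0 : (k%:R%:E * P (T (a n) @^-1` A `+` A) @[n --> \oo] --> 0)%E.
  rewrite -(mule0 k%:R%:E); apply: cvgeZl => //.
  exact: rigidity_sequence_measure.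
(* From index [m] on, the bound is strictly below the displacement of [A] under [g]. *)
have [m _ mlt] := kP0 _ (open_ereal_lt' PA0).
apply: (sub_finite_set _ (finite_II m)) => n /= ang.
rewrite ltnNge; apply/negP => /mlt /=.
by rewrite ltNge -{1}ang measure_setY_action_mulrn.
Qed.

Lemma mulrn_exponent_modn (G : zmodType) (e m n : nat) (x : G) :
  is_exponent G e -> m = n %[mod e] -> x *+ m = x *+ n.
Proof.
move=> [_ xe _] mn; rewrite (divn_eq m e) (divn_eq n e) mn.
by rewrite !mulrnDr !mulrnA !xe.
Qed.

Theorem proposition7p1 (R : realType) (G1 : finZmodType) (G2 : countZmodType)
    (e1 e2 : nat) (he1 : is_exponent G1 e1) (he2 : is_exponent G2 e2)
    (he12 : coprime e1 e2)
    (d : measure_display) (X : measurableType d) (P : probability X R)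
    (hP : nonatomic_lebesgue_space P)
    (T : (G1 * G2)%type -> X -> X)
    (hT : is_mp_action P T) (hfree : free_action P T)
    (a : nat -> (G1 * G2)%type) (ha : rigidity_sequence P T a) :
  finite_set [set n | (a n).1 <> 0].
Proof.
pose k := chinese e1 e2 1 0.
have ak n : a n *+ k = ((a n).1, 0).
  have fstM m (u : G1 * G2) : (u *+ m) = (u.1 *+ m, u.2 *+ m).
    by elim: m => [|m IH]; rewrite ?mulr0n// !mulrS IH.
  rewrite fstM (mulrn_exponent_modn _ he1 (chinese_modl he12 1 0)).
  by rewrite (mulrn_exponent_modn _ he2 (chinese_modr he12 1 0)).
(* Sorting the exceptional indices by the value of the first coordinate gives a finite union,
   because [G1] is finite. *)
apply: (@sub_finite_set _ _ (\bigcup_(g in [set g : G1 | g <> 0])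
    [set n | a n *+ k = (g, 0)])).
  by move=> n /= an0; exists (a n).1.
apply: bigcup_finite => [|g g0]; first exact: finite_finset.
by apply: (rigidity_sequence_mulrn_finite k hP hT hfree ha) => -[].
Qed.
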